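(* Consider the stochastic $K$-armed bandit with losses supported in $[0,1]$, and run the Regularized-EXP3 algorithm described in the context with mirror map $\phi_\alpha$, $\alpha\in[0,1]$, and parameters $\eta=1/\sqrt T$, $\varepsilon=\log T/\sqrt T$, $\lambda=\gamma_T/\sqrt{KT}$, where $(\gamma_T)$ is a positive sequence with $\gamma_T\le(\log T)^2$ and $\gamma_T/(\log T)^2\to0$, and, if $\alpha\in[0,\tfrac13)$, additionally $\log T/\gamma_T\to0$. Then the regret $\mathcal R(T)=\mathbb E[\sum_{t=1}^T\ell_t]-T\mu^\star$, with $\mu^\star=\min_j\mu_j$, satisfies $$\mathcal R(T)\le\begin{cases}\left(4\sqrt K\log T+\gamma_T\log T\right)\sqrt{KT}, & \alpha\in[0,\tfrac13),\\[2pt] \left(4\sqrt K\log K+2\sqrt K\log T+\gamma_T\log T\right)\sqrt{KT}, & \alpha\in[\tfrac13,1].\end{cases}$$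
   Context: Stochastic $K$-armed bandit (loss formulation): arm $a\in[K]$ has loss distribution $\mathcal P_a$ supported in $[0,1]$ with mean $\mu_a$; $\mu=(\mu_1,\dots,\mu_K)$. At round $t$ the learner chooses $A_t$ and observes $\ell_t\sim\mathcal P_{A_t}$ (independently of the past given $A_t$). $\Delta_\varepsilon=\{x\in\mathbb R^K: x_j\ge\varepsilon\ \forall j,\ \sum_jx_j=1\}$; $R_\varepsilon(x)=-\sum_i\ln x_i+\frac1\varepsilon\sum_ix_i$. Mirror maps on $\mathbb R^K_{>0}$: $\phi_\alpha(x)=-\sum_i\frac{x_i^\alpha-\alpha x_i-(1-\alpha)}{\alpha(1-\alpha)}$ for $0<\alpha<1$, $\phi_0(x)=-\sum_i(\log x_i-x_i+1)$, $\phi_1(x)=\sum_i(x_i\log x_i-x_i+1)$. $D_\phi(x,y)=\phi(x)-\phi(y)-\langle\nabla\phi(y),x-y\rangle$. Regularized-EXP3 (parameters $T,\eta,\lambda,\varepsilon$, mirror map $\phi$): $z_1=(1/K,\dots,1/K)$; for $t=1,\dots,T$: $x_t=\arg\min_{x\in\Delta_\varepsilon}D_\phi(x,z_t)$; draw $A_t$ with $\mathbb P(A_t=j\mid\text{past})=x_{t,j}$, observe $\ell_t$; $\widehat\ell_{t,j}=\mathbb I\{A_t=j\}\ell_t/x_{t,j}$; $\widetilde\ell_t=\widehat\ell_t+\lambda\nabla R_\varepsilon(x_t)$; $z_{t+1}=\arg\min_x\{\eta\langle\widetilde\ell_t,x\rangle+D_\phi(x,x_t)\}$. *)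

(* Defs.v *)
From HB Require Import structures.
From mathcomp Require Import all_boot all_order all_algebra.
From mathcomp Require Import all_classical all_reals all_analysis.
Set Implicit Arguments. Unset Strict Implicit. Unset Printing Implicit Defensive.
Import Order.TTheory GRing.Theory Num.Theory.
Import numFieldNormedType.Exports.
Local Open Scope classical_set_scope.
Local Open Scope ring_scope.

Section Bandit.
Variables (R : realType) (K : nat).

Definition vec := 'rV[R]_K.

Definition dotp (u v : vec) : R := \sum_(i < K) u 0 i * v 0 i.

Definition phi (alpha : R) (x : vec) : R :=
  if alpha == 0 then - \sum_(i < K) (ln (x 0 i) - x 0 i + 1)
  else if alpha == 1 then \sum_(i < K) (x 0 i * ln (x 0 i) - x 0 i + 1)
  else - \sum_(i < K)
         ((x 0 i `^ alpha - alpha * x 0 i - (1 - alpha)) / (alpha * (1 - alpha))).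

(* Bregman divergence D_phi(x,y) = phi x - phi y - <grad phi(y), x - y>;
   the inner product with the gradient is the directional derivative of
   phi at y in direction x - y. *)
Definition bregman (f : vec -> R) (x y : vec) : R :=
  f x - f y - 'D_(x - y) f y.

Definition posorth : set vec := [set x | forall i, 0 < x 0 i].

Definition Delta (eps : R) : set vec :=
  [set x | (forall j, eps <= x 0 j) /\ \sum_(j < K) x 0 j = 1].

Definition Reps (eps : R) (x : vec) : R :=
  - \sum_(i < K) ln (x 0 i) + eps^-1 * \sum_(i < K) x 0 i.

Definition grad (f : vec -> R) (x : vec) : vec :=
  \row_(i < K) 'D_(delta_mx 0 i) f x.

(* a minimizer of f over S (chosen with xget; unique in the situations used) *)
Definition argmin (S : set vec) (f : vec -> R) : vec :=
  xget 0 [set x | S x /\ forall y, S y -> f x <= f y].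

Section Alg.
Variables (alpha eta lambda eps : R).

Definition proj (z : vec) : vec := argmin (Delta eps) (fun x => bregman (phi alpha) x z).

(* z_{t+1} from z_t, the chosen arm a = A_t and the observed loss l = ell_t *)
Definition update (z : vec) (a : 'I_K) (l : R) : vec :=
  let x := proj z in
  let lhat := \row_(j < K) (if j == a then l / x 0 j else 0) in
  let ltil := lhat + lambda *: grad (Reps eps) x in
  argmin posorth (fun y => eta * dotp ltil y + bregman (phi alpha) y x).

Definition z1 : vec := \row_(i < K) (K%:R)^-1.

Variable P : 'I_K -> probability R R.

(* exp_loss n z = expected cumulative loss of the next n rounds when the
   current state is z_t = z: A_t is drawn with probabilities x_t = proj z,
   then ell_t ~ P_{A_t} independently of the past given A_t. *)
Fixpoint exp_loss (n : nat) (z : vec) : R :=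
  match n with
  | 0 => 0
  | n'.+1 => \sum_(j < K) proj z 0 j *
       Rintegral (P j) [set: R] (fun l => l + exp_loss n' (update z j l))
  end.

Definition mean (a : 'I_K) : R := Rintegral (P a) [set: R] (fun l => l).

Definition regret (i0 : 'I_K) (T : nat) : R :=
  exp_loss T z1 - T%:R * \big[Num.min/mean i0]_(j < K) mean j.

End Alg.
End Bandit.

(* Main.v *)
Require Import Defs.
From HB Require Import structures.
From mathcomp Require Import all_boot all_order all_algebra.
From mathcomp Require Import all_classical all_reals all_analysis.
From mathcomp Require Import measurable_realfun.
From mathcomp Require Import ring lra.
Import Order.TTheory GRing.Theory Num.Theory.
Import numFieldNormedType.Exports.
Local Open Scope classical_set_scope.
Local Open Scope ring_scope.

(* Mirror descent against the comparator u that puts eps on every arm and the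
   remaining mass on a best arm b. The mirror map is separable, phi x = sum_i psi (x_i)
   with psi'' y = y^(alpha - 2), so D(u, .) is a potential: the three-point identity
   and the Pythagorean inequality for the projection give
     D(u, z_{t+1}) <= D(u, z_t) + eta <l~_t, u - x_t> + D(x_t, z_{t+1}).
   The regularized losses l~_t are nonnegative on Delta_eps, hence z_{t+1} <= x_t and
   the last term is at most eta^2/2 sum_i x_i l~_{t,i}^2, because psi'' y >= 1/y
   on ]0, 1]. Induction on the number of remaining rounds then bounds the
   expected loss by T (mu_b + C) + D(u, z_1) / eta, with C collecting the bias (K - 1) eps
   of u, the barrier term lambda <grad R(x), u - x> <= lambda (K - 1) (- ln (K eps)) and the
   quadratic term. Everything else is explicit: D(u, z_1) <= 3/2 (K - 1) (- ln (K eps)) for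
   alpha < 1/3 and D(u, z_1) <= 3 K ln K for alpha >= 1/3. *)

(** * One-dimensional mirror maps and their Bregman divergences *)

Section ScalarMirror.
Set Implicit Arguments. Unset Strict Implicit.
Context {R : realType}.

(** [mirror_geV] is the curvature bound behind the quadratic term. [mirror_solve] makes the mirror
    step solvable; it asks for [0 <= g] because [f1] may be bounded above, as [1 - y^-1] is. *)
Record mirror (f f1 f2 : R -> R) : Prop := Mirror {
  mirror_derive : forall y : R, 0 < y -> is_derive y 1 f (f1 y) ;
  mirror_derive2 : forall y : R, 0 < y -> is_derive y 1 f1 (f2 y) ;
  mirror_gt0 : forall y : R, 0 < y -> 0 < f2 y ;
  mirror_geV : forall y : R, 0 < y <= 1 -> y^-1 <= f2 y ;
  mirror_solve : forall x g : R, 0 < x -> 0 <= g -> exists2 z, 0 < z & f1 z = f1 x - g }.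

Definition div1 (f f1 : R -> R) (x y : R) : R := f x - f y - f1 y * (x - y).

Lemma MVT_gt0 {f f1 : R -> R} {a b : R} : (forall y : R, 0 < y -> is_derive y 1 f (f1 y)) ->
  0 < a -> a < b -> exists2 c, a < c < b & f b - f a = f1 c * (b - a).
Proof.
move=> df a0 ab; have [||c] := @MVT R f f1 a b ab.
- by move=> x /itvP xab; apply: df; rewrite (lt_trans a0)// xab.
- apply: derivable_within_continuous => x /itvP xab.
  by apply: ex_derive; apply: df; rewrite (lt_le_trans a0)// xab.
- by move=> /itvP cab e; exists c => //; rewrite !cab.
Qed.

Lemma div1_three_point (f f1 : R -> R) (u x z : R) :
  div1 f f1 u z = div1 f f1 u x + div1 f f1 x z + (f1 x - f1 z) * (u - x).
Proof. by rewrite /div1; ring. Qed.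

Lemma is_derive_div1 (f f1 : R -> R) (y z : R) : is_derive y 1 f (f1 y) ->
  is_derive y 1 (div1 f f1 ^~ z) (f1 y - f1 z).
Proof.
move=> df.
have : is_derive y 1 (f - cst (f z) - f1 z *: (id - cst z)) (f1 y - f1 z).
  by apply: is_derive_eq; rewrite !subr0 /GRing.scale/= mulr1.
by [].
Qed.

Section Mirror.
Variables (f f1 f2 : R -> R).
Hypothesis m : mirror f f1 f2.

Lemma mirror_lt {a b : R} : 0 < a -> a < b -> f1 a < f1 b.
Proof.
move=> a0 ab; have [c /andP[ac cb] e] := MVT_gt0 (mirror_derive2 m) a0 ab.
rewrite -subr_gt0 e mulr_gt0 ?subr_gt0//.
by apply: (mirror_gt0 m); rewrite (lt_trans a0).
Qed.

(** Mean value theorem and strict monotonicity of [f1]. Strictness is what later pins the mirror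
    step to a single point. *)
Lemma div1_gt0 (y z : R) : 0 < y -> 0 < z -> y != z -> 0 < div1 f f1 y z.
Proof.
move=> y0 z0; rewrite neq_lt => /orP[yz|zy]; rewrite /div1.
- have [c /andP[yc cz] e] := MVT_gt0 (mirror_derive m) y0 yz.
  rewrite (_ : _ - _ - _ = (f1 z - f1 c) * (z - y)); last first.
    by rewrite mulrBl -e; ring.
  by rewrite mulr_gt0 ?subr_gt0// mirror_lt// (lt_trans y0).
- have [c /andP[zc cy] e] := MVT_gt0 (mirror_derive m) z0 zy.
  by rewrite e -mulrBl mulr_gt0 ?subr_gt0// mirror_lt.
Qed.

Lemma div1_ge0 (y z : R) : 0 < y -> 0 < z -> 0 <= div1 f f1 y z.
Proof.
move=> y0 z0; have [->|/div1_gt0 H] := eqVneq y z; last exact/ltW/H.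
by rewrite /div1 !subrr mulr0 subrr.
Qed.

(* As a function of z, the right-hand side minus the left-hand side vanishes at
   x and has derivative of the sign of (x - z) - x * (f1 x - f1 z) <= 0, because
   f1 has slope at least 1/x on ]0, x]. *)
Lemma div1_le_sqr (x z : R) : 0 < z -> z <= x -> x <= 1 ->
  div1 f f1 x z <= 2^-1 * x * (f1 x - f1 z) ^+ 2.
Proof.
move=> z0; rewrite le_eqVlt => /orP[/eqP<-|zx] x1.
  by rewrite /div1 !subrr mulr0 subrr expr0n mulr0.
have x0 := lt_trans z0 zx.
pose h w := 2^-1 * x * (f1 x - f1 w) ^+ 2 - div1 f f1 x w.
pose h1 w := f2 w * ((x - w) - x * (f1 x - f1 w)).
have dh (w : R) : 0 < w -> is_derive w 1 h (h1 w).
  move=> w0; have d1 := mirror_derive m w0; have d2 := mirror_derive2 m w0.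
  have H : is_derive w 1 ((2^-1 * x) *: (cst (f1 x) - f1) ^+ 2
            - (cst (f x) - f - f1 * (cst x - id))) (h1 w).
    apply: is_derive_eq.
    by rewrite /h1 /GRing.scale/= !fctE/=; lra.
  suff -> : h = (2^-1 * x) *: (cst (f1 x) - f1) ^+ 2
            - (cst (f x) - f - f1 * (cst x - id)) by [].
  by apply: funext => v; rewrite /h /div1 !fctE.
have [c /andP[zc cx]] := MVT_gt0 dh z0 zx.
have c0 := lt_trans z0 zc.
have -> : h x = 0 by rewrite /h /div1 !subrr expr0n !mulr0 !subrr.
rewrite -subr_ge0 -/(h z) sub0r => e.
rewrite -oppr_le0 e /h1 -mulrA mulr_ge0_le0 ?(ltW (mirror_gt0 m _))//.
rewrite mulr_le0_ge0 ?subr_ge0 ?(ltW zx)// subr_le0.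
have [b /andP[cb bx] ->] := MVT_gt0 (mirror_derive2 m) c0 cx.
have b0 := lt_trans c0 cb.
have fb : b^-1 <= f2 b by apply: (mirror_geV m); rewrite b0 (le_trans (ltW bx)).
rewrite mulrA ler_peMl ?subr_ge0 ?(ltW cx)//.
rewrite -(ler_pdivrMl _ _ x0) mulr1 (le_trans _ fb)// lef_pV2 ?posrE// ltW//.
Qed.

End Mirror.
End ScalarMirror.

(** * The power family as scalar mirror maps *)

Section PowerMirror.
Set Implicit Arguments. Unset Strict Implicit.
Context {R : realType}.
Variable alpha : R.

Definition psi (y : R) : R :=
  if alpha == 0 then - (ln y - y + 1)
  else if alpha == 1 then y * ln y - y + 1
  else - ((y `^ alpha - alpha * y - (1 - alpha)) / (alpha * (1 - alpha))).

(** Only [alpha = 1] is singular: at [alpha = 0] the general formula reads [1 - y^-1], the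
    derivative of the logarithmic branch of [psi]. *)
Definition dpsi (y : R) : R :=
  if alpha == 1 then ln y else (1 - y `^ (alpha - 1)) / (1 - alpha).

Lemma phi_sum (K : nat) (x : 'rV[R]_K) : phi alpha x = \sum_(i < K) psi (x 0 i).
Proof.
by rewrite /phi /psi; case: ifP => _; [|case: ifP => _]; rewrite ?sumrN.
Qed.

Lemma is_derive_psi (y : R) : 0 < y -> is_derive y 1 psi (dpsi y).
Proof.
move=> y0; rewrite /psi /dpsi.
have dln := is_derive1_ln y0; have dpow := is_derive1_powR alpha y0.
have [->|a0] := eqVneq alpha 0.
  rewrite eq_sym oner_eq0 sub0r subr0 divr1 powR_inv1 ?ltW//.
  have H : is_derive y 1 (- (@ln R - id + cst 1)) (1 - y^-1).
    by apply: is_derive_eq; rewrite addr0 opprB.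
  by [].
have [_|a1] := eqVneq alpha 1.
  have H : is_derive y 1 (id * @ln R - id + cst 1) (ln y).
    apply: is_derive_eq; rewrite /GRing.scale/=.
    by field; rewrite gt_eqF.
  by [].
have a1' : 1 - alpha != 0 by rewrite subr_eq0 eq_sym.
have H : is_derive y 1
    (- ((alpha * (1 - alpha))^-1 *:
        ((fun y => y `^ alpha) - alpha *: id - cst (1 - alpha))))
    ((1 - y `^ (alpha - 1)) / (1 - alpha)).
  apply: is_derive_eq; rewrite /GRing.scale/=.
  by field; rewrite a1' a0.
suff -> : (fun y : R =>
      - ((y `^ alpha - alpha * y - (1 - alpha)) / (alpha * (1 - alpha)))) =
    - ((alpha * (1 - alpha))^-1 *:
       ((fun y => y `^ alpha) - alpha *: id - cst (1 - alpha))) by [].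
by apply: funext => v; rewrite !fctE /GRing.scale/= mulrC.
Qed.

Lemma is_derive_dpsi (y : R) : 0 < y -> is_derive y 1 dpsi (y `^ (alpha - 2)).
Proof.
move=> y0; rewrite /dpsi; have dpow := is_derive1_powR (alpha - 1) y0.
have [->|a1] := eqVneq alpha 1.
  rewrite (_ : 1 - 2 = -1); last lra.
  rewrite powR_inv1 ?ltW//; exact: is_derive1_ln.
have a1' : 1 - alpha != 0 by rewrite subr_eq0 eq_sym.
have H : is_derive y 1
    ((1 - alpha)^-1 *: (cst 1 - (fun y => y `^ (alpha - 1)))) (y `^ (alpha - 2)).
  apply: is_derive_eq; rewrite /GRing.scale/=.
  rewrite (_ : alpha - 1 - 1 = alpha - 2); last lra.
  by field.
suff -> : (fun y : R => (1 - y `^ (alpha - 1)) / (1 - alpha)) =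
   ((1 - alpha)^-1 *: (cst 1 - (fun y => y `^ (alpha - 1)))) by [].
by apply: funext => v; rewrite !fctE /GRing.scale/= mulrC.
Qed.

Lemma psi_mirror : 0 <= alpha <= 1 -> mirror psi dpsi (fun y => y `^ (alpha - 2)).
Proof.
move=> /andP[a0 a1]; split.
- exact: is_derive_psi.
- exact: is_derive_dpsi.
- by move=> y y0; exact: powR_gt0.
- move=> y /andP[y0 y1]; rewrite -powR_inv1 ?(ltW y0)//.
  have H : 0 < y <= 1 by rewrite y0.
  by apply: (ger_powR H); lra.
- move=> x g x0 g0; rewrite /dpsi.
  have [_|/eqP a1'] := eqVneq alpha 1.
    exists (x * expR (- g)); first by rewrite mulr_gt0 ?expR_gt0.
    by rewrite lnM ?posrE ?expR_gt0// expRK.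
  have a1'' : 0 < 1 - alpha by rewrite subr_gt0 lt_neqAle a1 andbT; apply/eqP.
  (* For [alpha < 1] the equation [dpsi z = dpsi x - g] says that [z] to the power [alpha - 1]
     equals [w], which is positive since [0 <= g]. *)
  set w := x `^ (alpha - 1) + (1 - alpha) * g.
  have w0 : 0 < w.
    by rewrite ltr_wpDr ?powR_gt0// mulr_ge0// ltW.
  exists (w `^ (alpha - 1)^-1); first exact: powR_gt0.
  rewrite -powRrM mulVf ?powRr1 ?(ltW w0)//; last lra.
  by rewrite /w; field; rewrite gt_eqF.
Qed.

End PowerMirror.

(** * Directional derivatives of separable functions *)

Section SeparableDerivative.
Set Implicit Arguments. Unset Strict Implicit.
Context {R : realType} {K : nat}.

Lemma is_derive_separable (f f1 : 'I_K -> R -> R) (x v : 'rV[R]_K) :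
  (forall i, is_derive (x 0 i) 1 (f i) (f1 i (x 0 i))) ->
  is_derive x v (fun y : 'rV[R]_K => \sum_i f i (y 0 i))
    (\sum_i f1 i (x 0 i) * v 0 i).
Proof.
move=> df.
have dG : is_derive (0 : R) 1 (fun h : R => \sum_i f i (h * v 0 i + x 0 i))
    (\sum_i f1 i (x 0 i) * v 0 i).
  have H : is_derive (0 : R) 1
      (\sum_i (f i \o ( *%R^~ (v 0 i) + cst (x 0 i))))
      (\sum_i f1 i (x 0 i) * v 0 i).
    apply: is_derive_sum => i; apply: is_derive1_comp.
      by rewrite !fctE mul0r add0r.
    have H : is_derive (0 : R) 1 (v 0 i *: id + cst (x 0 i)) (v 0 i).
      by apply: is_derive_eq; rewrite /GRing.scale/= mulr1 addr0.
    suff -> : *%R^~ (v 0 i) + cst (x 0 i) = v 0 i *: id + cst (x 0 i) by [].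
    by apply: funext => h; rewrite !fctE /GRing.scale/= mulrC.
  suff -> : (fun h : R => \sum_i f i (h * v 0 i + x 0 i)) =
    \sum_i (f i \o ( *%R^~ (v 0 i) + cst (x 0 i))) by [].
  by apply: funext => h; rewrite fct_sumE.
(* The difference quotient along [v] at [x] is that of a function of one real variable at 0, where
   the sum and chain rules apply. *)
have e : (fun h : R => h^-1 *: (((fun y : 'rV[R]_K => \sum_i f i (y 0 i)) \o shift x) (h *: v)
     - \sum_i f i (x 0 i))) =
  (fun h : R => h^-1 *: (((fun h : R => \sum_i f i (h * v 0 i + x 0 i)) \o shift (0 : R)) (h *: 1)
     - \sum_i f i (0 * v 0 i + x 0 i))).
  apply: funext => h /=; congr (_ *: (_ - _)).
    by apply: eq_bigr => i _; rewrite !mxE addr0 /GRing.scale/= mulr1.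
  by apply: eq_bigr => i _; rewrite mul0r add0r.
case: dG => dG vG; split; first by rewrite /derivable e.
by rewrite -vG /derive e.
Qed.

Lemma is_derive_log_barrier (c t : R) : 0 < t ->
  is_derive t 1 (fun t => c * t - ln t) (c - t^-1).
Proof.
move=> t0; have dln := is_derive1_ln t0.
have : is_derive t 1 (c *: id - @ln R) (c - t^-1).
  by apply: is_derive_eq; rewrite /GRing.scale/= mulr1.
by [].
Qed.

End SeparableDerivative.

(** * Minimizers and compactness of the truncated simplex *)

Section Argmin.
Set Implicit Arguments. Unset Strict Implicit.
Context {R : realType} {K : nat}.
Implicit Types (S : set 'rV[R]_K) (f : 'rV[R]_K -> R).

(** [argmin] is a choice with default 0, so each use of it rests on first showing that the minimum
    is attained. *)
Lemma argminP S f : (exists2 x, S x & forall y, S y -> f x <= f y) ->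
  S (argmin S f) /\ forall y, S y -> f (argmin S f) <= f y.
Proof. by move=> [x Sx xmin]; apply: (@xgetPex _ 0 [set x | S x /\ _]); exists x. Qed.

Lemma continuous_separable (f : 'I_K -> R -> R) (x : 'rV[R]_K) :
  (forall i, {for x 0 i, continuous (f i)}) ->
  {for x, continuous (fun y : 'rV[R]_K => \sum_i f i (y 0 i))}.
Proof.
move=> cf; elim: (index_enum _) => [|i s IH].
  rewrite (_ : (fun _ => _) = cst 0); first exact: cst_continuous.
  by apply: funext => y; rewrite big_nil.
rewrite (_ : (fun _ => _) = (fun y : 'rV[R]_K => f i (y 0 i)) \+
  (fun y : 'rV[R]_K => \sum_(j <- s) f j (y 0 j))); last first.
  by apply: funext => y; rewrite big_cons.
apply: (@continuousD _ _ _ (fun y : 'rV[R]_K => f i (y 0 i))) => //.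
by apply: (@continuous_comp _ _ _ (fun y : 'rV[R]_K => y 0 i));
  [exact: coord_continuous|exact: cf].
Qed.

Lemma Delta_le1 (eps : R) (x : 'rV[R]_K) : 0 <= eps -> Delta eps x ->
  forall i, x 0 i <= 1.
Proof.
move=> e0 [xe <-] i; rewrite (bigD1 i)//= lerDl sumr_ge0// => j _.
exact: le_trans (xe j).
Qed.

Lemma compact_Delta (eps : R) : 0 <= eps -> compact (@Delta R K eps).
Proof.
move=> e0.
have -> : @Delta R K eps = [set x : 'rV[R]_K | forall i, `[eps, 1]%classic (x ord0 i)]
    `&` [set x | \sum_i x 0 i = 1].
  apply/seteqP; split => x /=.
    move=> Dx; split; last by case: Dx.
    by move=> i; rewrite in_itv/= (Delta_le1 e0 Dx) andbT; case: Dx.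
  by move=> [xi x1]; split => // i; have := xi i; rewrite in_itv/= => /andP[].
apply: compact_closedI.
  by apply: (@rV_compact R K (fun=> `[eps, 1]%classic)) => i; exact: segment_compact.
have H : continuous (fun x : 'rV[R]_K => \sum_i x 0 i).
  move=> x; apply: (@continuous_separable (fun=> id)) => i; exact: cvg_id.
by move/continuous_closedP : H => /(_ _ (@closed_eq R 1)).
Qed.

End Argmin.

(** * The projection and the mirror step of one round *)

Section Steps.
Set Implicit Arguments. Unset Strict Implicit.
Context {R : realType} {K : nat}.
Variable alpha : R.
Hypothesis alpha01 : 0 <= alpha <= 1.
Implicit Types x y z u : 'rV[R]_K.

Local Notation d := (div1 (psi alpha) (dpsi alpha)).

(** A form of [bregman (phi alpha)] without directional derivatives; the two agree when the base
    point [y] is positive. *)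
Definition Dpsi x y : R := \sum_i d (x 0 i) (y 0 i).

Lemma bregman_phi x y : posorth y -> bregman (phi alpha) x y = Dpsi x y.
Proof.
move=> y0; rewrite /bregman.
have -> : phi alpha = fun x : 'rV[R]_K => \sum_i psi alpha (x 0 i).
  by apply: funext => v; rewrite phi_sum.
have H := @is_derive_separable R K (fun=> psi alpha) (fun=> dpsi alpha) y (x - y)
  (fun i => is_derive_psi alpha (y0 i)).
rewrite derive_val -!sumrB; apply: eq_bigr => i _.
by rewrite /div1 !mxE.
Qed.

(** On [Delta eps] this value lies between 0 and [eps^-1]: the lower bound keeps the regularized
    losses nonnegative, the upper one controls their squares. *)
Lemma grad_Reps (eps : R) x i : posorth x ->
  grad (Reps eps) x 0 i = eps^-1 - (x 0 i)^-1.
Proof.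
move=> x0; rewrite /grad mxE.
have -> : Reps eps = fun x : 'rV[R]_K => \sum_i (eps^-1 * x 0 i - ln (x 0 i)).
  by apply: funext => v; rewrite /Reps sumrB addrC mulr_sumr.
have dR j : is_derive (x 0 j) 1 (fun t => eps^-1 * t - ln t) (eps^-1 - (x 0 j)^-1).
  exact: is_derive_log_barrier.
have [_ ->] := @is_derive_separable R K (fun=> fun t => eps^-1 * t - ln t)
  (fun=> fun t => eps^-1 - t^-1) x (delta_mx 0 i) dR.
rewrite (bigD1 i)//= big1 ?addr0 => [|j ji]; first by rewrite mxE !eqxx mulr1.
by rewrite mxE (negbTE ji) andbF mulr0.
Qed.

Lemma Dpsi_ge0 x y : posorth x -> posorth y -> 0 <= Dpsi x y.
Proof. by move=> x0 y0; apply: sumr_ge0 => i _; exact: (div1_ge0 (psi_mirror alpha01)). Qed.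

Lemma Delta_posorth (eps : R) x : 0 < eps -> Delta eps x -> posorth x.
Proof. by move=> e0 [xe _] i; exact: lt_le_trans (xe i). Qed.

(** Extreme value theorem on the compact [Delta eps], where [Dpsi^~ z] is continuous because the
    coordinates stay above [eps > 0]. *)
Lemma projP (eps : R) z : 0 < eps -> @Delta R K eps !=set0 -> posorth z ->
  Delta eps (Defs.proj alpha eps z) /\
  forall y, Delta eps y -> Dpsi (Defs.proj alpha eps z) z <= Dpsi y z.
Proof.
move=> e0 D0 z0; rewrite /Defs.proj.
have -> : (fun x : vec R K => bregman (phi alpha) x z) = Dpsi^~ z.
  by apply: funext => x; exact: bregman_phi.
apply: argminP.
have [||c cD cmin] := @EVT_min_rV R K (Dpsi^~ z) (Delta eps) D0.
- exact/compact_Delta/ltW.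
- apply: continuous_in_subspaceT => x; rewrite inE => Dx.
  apply: (@continuous_separable _ _ (fun i => d^~ (z 0 i))) => i.
  have [dx _] := is_derive_div1 (z 0 i) (is_derive_psi alpha (Delta_posorth e0 Dx i)).
  by apply: differentiable_continuous; apply/derivable1_diffP.
- by exists c => [|y Dy]; [rewrite inE in cD|apply: cmin; rewrite inE].
Qed.

(* First-order optimality of the projection along the segment to u. *)
Lemma proj_pythagoras (eps : R) z u : 0 < eps -> posorth z -> Delta eps u ->
  Dpsi u (Defs.proj alpha eps z) <= Dpsi u z.
Proof.
move=> e0 z0 Du.
have [] := @projP eps z e0 (ex_intro _ u Du) z0.
set x := Defs.proj alpha eps z => Dx xmin.
have x0 := Delta_posorth e0 Dx.
pose L := \sum_i (dpsi alpha (x 0 i) - dpsi alpha (z 0 i)) * (u - x) 0 i.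
(* [L] is the derivative of [Dpsi^~ z] at [x] towards [u], and also the last term of the three-point
   identity. *)
suff L0 : 0 <= L.
  have -> : Dpsi u z = Dpsi u x + Dpsi x z + L.
    rewrite -!big_split; apply: eq_bigr => i _ /=.
    by rewrite (div1_three_point _ _ _ (x 0 i)) !mxE.
  by rewrite -addrA lerDl addr_ge0// Dpsi_ge0.
have [] : is_derive x (u - x) (Dpsi^~ z) L.
  apply: (@is_derive_separable _ _ (fun i => d^~ (z 0 i))
    (fun i t => dpsi alpha t - dpsi alpha (z 0 i))) => i.
  exact: is_derive_div1 (is_derive_psi alpha (x0 i)).
move=> dL vL.
have := dL; rewrite /derivable => /cvg_dnbhs_at_right cL.
rewrite -vL; apply: (cvgr_to_ge cL).
near=> h.
have h0 : 0 < h by near: h; exact: nbhs_right_gt.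
have h1 : h < 1 by near: h; exact: nbhs_right_lt.
rewrite /GRing.scale/= mulr_ge0 ?invr_ge0 ?(ltW h0)// subr_ge0.
apply: xmin; case: Dx => xe x1; case: Du => ue u1; split.
  move=> j; rewrite !mxE.
  have := xe j; have := ue j => uj xj.
  have -> : h * (u 0 j - x 0 j) + x 0 j =
    eps + (h * (u 0 j - eps) + (1 - h) * (x 0 j - eps)) by ring.
  by rewrite lerDl addr_ge0// mulr_ge0 ?subr_ge0// ltW.
rewrite (eq_bigr (fun j => h * (u 0 j - x 0 j) + x 0 j)); last by move=> j _; rewrite !mxE.
by rewrite big_split/= -mulr_sumr sumrB u1 x1 subrr mulr0 add0r.
Unshelve. all: by end_near.
Qed.

(** The stationarity equation is solved coordinate by coordinate, giving [zs]. The objective is then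
    [Dpsi^~ zs] up to a constant, so [zs] is its only positive minimizer. *)
Lemma updateP (eta lambda eps : R) z a (l : R) (x := Defs.proj alpha eps z)
  (g := fun i => (if i == a then l / x 0 i else 0) + lambda * (eps^-1 - (x 0 i)^-1)) :
  0 < eta -> 0 <= lambda -> 0 < eps -> @Delta R K eps !=set0 -> posorth z -> 0 <= l ->
  let z' := update alpha eta lambda eps z a l in
  posorth z' /\ forall i, dpsi alpha (z' 0 i) = dpsi alpha (x 0 i) - eta * g i.
Proof.
move=> eta0 la0 e0 D0 z0 l0 z'.
have [Dx _] := projP e0 D0 z0.
have x0 : posorth x := Delta_posorth e0 Dx.
have g0 i : 0 <= g i.
  rewrite addr_ge0//; first by case: ifP => // _; rewrite divr_ge0// ltW.
  by rewrite mulr_ge0// subr_ge0 lef_pV2 ?posrE//; case: Dx.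
pose w i := sval (cid2 (mirror_solve (psi_mirror alpha01) (x0 i) (mulr_ge0 (ltW eta0) (g0 i)))).
have w0 i : 0 < w i by rewrite /w; case: cid2.
have wE i : dpsi alpha (w i) = dpsi alpha (x 0 i) - eta * g i by rewrite /w; case: cid2.
pose zs : 'rV[R]_K := \row_i w i.
have zs0 : posorth zs by move=> i; rewrite mxE.
(* The three-point identity at [y], [x], [zs] leaves exactly this constant, since
   [dpsi (x i) - dpsi (zs i) = eta * g i]. *)
pose c := \sum_i (eta * g i * x 0 i - d (x 0 i) (zs 0 i)).
pose F := fun y : 'rV[R]_K => Dpsi y zs + c.
have [z'0 z'min] : posorth z' /\ forall y, posorth y -> F z' <= F y.
  rewrite /z' /update -/x.
  rewrite (_ : (fun y => _ + _) = F); last first.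
    apply: funext => y; rewrite bregman_phi// /F /dotp mulr_sumr -!big_split/=.
    apply: eq_bigr => i _; rewrite (div1_three_point _ _ (y 0 i) (x 0 i) (zs 0 i)).
    rewrite [X in eta * (X * _)](_ : _ = g i); last first.
      by rewrite mxE; congr (_ + _); rewrite [LHS]mxE ?grad_Reps.
    by rewrite mxE wE; ring.
  apply: argminP; exists zs => // y y0.
  rewrite lerD2r (_ : Dpsi zs zs = 0) ?Dpsi_ge0//.
  by apply: big1 => i _; rewrite /div1 !subrr mulr0 subrr.
split=> // i.
have : Dpsi z' zs <= 0.
  have := z'min _ zs0; rewrite lerD2r => /le_trans; apply.
  rewrite (_ : Dpsi zs zs = 0)//.
  by apply: big1 => j _; rewrite /div1 !subrr mulr0 subrr.
have [->|ne] := eqVneq (z' 0 i) (zs 0 i); first by rewrite mxE wE.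
rewrite leNgt => /negP[].
rewrite /Dpsi (bigD1 i)//= ltr_pwDl ?(div1_gt0 (psi_mirror alpha01))//.
by apply: sumr_ge0 => j _; apply: (div1_ge0 (psi_mirror alpha01)).
Qed.

End Steps.

(** * Integration against laws supported in the unit interval *)

Section Integration.
Import HBNNSimple.
Set Implicit Arguments. Unset Strict Implicit.
Context {R : realType}.

(* The integral of an arbitrary nonnegative function is a supremum over the simple
   functions below it, so no measurability of f is needed; when the negative
   part of f has infinite integral, Rintegral is 0. *)
Lemma Rintegral_ae_le (d : measure_display) (T : measurableType d)
    (mu : {measure set T -> \bar R}) (f g : T -> R) (A : set T) :
  measurable A -> mu (~` A) = 0%E -> mu.-integrable setT (EFin \o g) ->
  (forall x, A x -> f x <= g x) -> (forall x, A x -> 0 <= g x) ->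
  Rintegral mu setT f <= Rintegral mu setT g.
Proof.
move=> mA muA ig fg g0.
have [mg _] := integrableP _ _ _ ig.
have mgp := measurable_funepos mg.
have fgp : (\int[mu]_x (EFin \o f)^\+ x <= \int[mu]_x (EFin \o g)^\+ x)%E.
  (* A simple function below the positive part of [f] is almost everywhere below that of [g]. *)
  rewrite ge0_integralTE//; apply: ge_ereal_sup => _ [h /= hf <-].
  rewrite -integralT_nnsfun; apply: ae_ge0_le_integral => //.
  - by move=> x _; rewrite lee_fin.
  - exact/measurable_EFinP/measurable_funP.
  - exists (~` A); split => //; first exact: measurableC.
    move=> x /=; apply: contra_not => Ax _; apply: le_trans (hf x) _.
    by rewrite !funeposE ge_max !le_max !lee_fin fg//= lexx orbT.
have gE : (\int[mu]_x (g x)%:E = \int[mu]_x (EFin \o g)^\+ x)%E.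
  apply: ae_eq_integral => //; exists (~` A); split => //; first exact: measurableC.
  move=> x /=; apply: contra_not => Ax _.
  by rewrite funeposE; apply/esym/max_idPl; rewrite lee_fin g0.
have gfin : (\int[mu]_x (EFin \o g)^\+ x)%E \is a fin_num.
  by rewrite -gE; apply: integrable_fin_num.
rewrite /Rintegral gE (integralE _ _ (EFin \o f)).
have fp0 : (0 <= \int[mu]_x (EFin \o f)^\+ x)%E by exact: integral_ge0.
have fn0 : (0 <= \int[mu]_x (EFin \o f)^\- x)%E by exact: integral_ge0.
move: fgp gfin fp0 fn0.
case: (\int[mu]_x (EFin \o g)^\+ x)%E => [s| |]// + _.
case: (\int[mu]_x (EFin \o f)^\+ x)%E => [r| |]//=.
case: (\int[mu]_x (EFin \o f)^\- x)%E => [q| |]//=; rewrite !lee_fin => *; lra.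
Qed.

Section UnitSupport.
Variable P : probability R R.
Hypothesis suppP : P `[0, 1]%classic = 1%E.

Lemma null_outside_itv01 : P (~` `[0, 1]%classic) = 0%E.
Proof. by rewrite probability_setC// suppP subee. Qed.

Lemma integrable_id_itv01 : P.-integrable setT (EFin \o (@id R)).
Proof.
apply/integrableP; split; first exact/measurable_EFinP.
apply: (@le_lt_trans _ _ (\int[P]_x (cst 1 x))%E); last first.
  by rewrite integral_cst//= mul1e probability_setT ltry.
apply: ae_ge0_le_integral => //.
- by apply/measurableT_comp => //; exact/measurable_EFinP.
- exists (~` `[0, 1]%classic); split; [exact: measurableC|exact: null_outside_itv01|].
  move=> x /=; apply: contra_not; rewrite in_itv/= => /andP[x0 x1] _.
  by rewrite lee_fin ger0_norm.
Qed.

Lemma integrable_affine (a b : R) :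
  P.-integrable setT (EFin \o (fun l => a * l + b)).
Proof.
rewrite (_ : _ \o _ = ((fun l => (a * l)%:E) \+ (fun=> b%:E))%E)//.
apply: integrableD => //; last exact: finite_measure_integrable_cst.
rewrite (_ : (fun l => _) = (fun l : R => a%:E * (EFin \o id) l)%E)//.
exact: integrableZl integrable_id_itv01.
Qed.

Lemma Rintegral_affine (a b : R) :
  Rintegral P setT (fun l => a * l + b) = a * Rintegral P setT (fun l => l) + b.
Proof.
have ia : P.-integrable setT (EFin \o (fun l => a * l)).
  by have := integrable_affine a 0; under eq_fun do rewrite addr0.
rewrite (@RintegralD _ _ _ P setT (fun l => a * l) (fun=> b))//; last first.
  exact: finite_measure_integrable_cst.
rewrite (@RintegralZl _ _ _ P setT id)//; last exact: integrable_id_itv01.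
by rewrite Rintegral_cst//= probability_setT mulr1.
Qed.

Lemma Rintegral_id_itv01 : 0 <= Rintegral P setT (fun l => l) <= 1.
Proof.
have m01 : measurable (`[0, 1]%classic : set R) by exact: measurable_itv.
have -> : 1 = Rintegral P setT (fun=> 1).
  by rewrite Rintegral_cst//= probability_setT mulr1.
have i1 := finite_measure_integrable_cst P (1 : R) measurableT.
apply/andP; split; last first.
  apply: (Rintegral_ae_le m01 null_outside_itv01) => //=.
  by move=> x; rewrite in_itv/= => /andP[].
have := @Rintegral_ae_le _ _ P (fun l => 0) (fun l => l) _ m01 null_outside_itv01
  integrable_id_itv01.
rewrite Rintegral_cst// mul0r; apply => x /=; rewrite in_itv/= => /andP[]//.
Qed.

End UnitSupport.
End Integration.

(** * The potential argument over all rounds, for an abstract comparator [u] *)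

Section Potential.
Set Implicit Arguments. Unset Strict Implicit.
Context {R : realType} {K : nat}.
Variables (alpha eta lambda eps : R).
Hypothesis alpha01 : 0 <= alpha <= 1.
Hypotheses (eta_gt0 : 0 < eta) (lambda_ge0 : 0 <= lambda) (eps_gt0 : 0 < eps).
Variables (u : 'rV[R]_K) (rho : R).
Hypothesis Delta_u : Delta eps u.
Hypothesis rho_ge0 : 0 <= rho.
Hypothesis rhoP : forall x : 'rV[R]_K, Delta eps x ->
  \sum_i (eps^-1 - (x 0 i)^-1) * (u 0 i - x 0 i) <= rho.

Let D0 : @Delta R K eps !=set0. Proof. by exists u. Qed.

(** Only the played arm carries a loss term; its square yields [(x 0 a)^-1] and a cross term. The
    barrier parts are at most [lambda / eps] and are averaged by the weights [x]. *)
Lemma sum_sqr_estimate (x : 'rV[R]_K) (a : 'I_K) (l : R) :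
  Delta eps x -> 0 <= l <= 1 ->
  \sum_i x 0 i * ((if i == a then l / x 0 i else 0)
                  + lambda * (eps^-1 - (x 0 i)^-1)) ^+ 2
  <= (x 0 a)^-1 + 2 * (lambda / eps) + (lambda / eps) ^+ 2.
Proof.
move=> Dx /andP[l0 l1]; have x0 := Delta_posorth eps_gt0 Dx.
pose b i := lambda * (eps^-1 - (x 0 i)^-1).
have b0 i : 0 <= b i.
  by rewrite mulr_ge0// subr_ge0 lef_pV2 ?posrE//; case: Dx.
have bl i : b i <= lambda / eps.
  by rewrite ler_wpM2l// gerBl invr_ge0 ltW.
have q0 : 0 <= lambda / eps by rewrite divr_ge0// ltW.
have -> : (lambda / eps) ^+ 2 = \sum_i x 0 i * (lambda / eps) ^+ 2.
  by rewrite -mulr_suml; case: Dx => _ ->; rewrite mul1r.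
rewrite (bigD1 a)//= [in leRHS](bigD1 a)//= eqxx addrA lerD//; last first.
  apply: ler_sum => i /negbTE ->; rewrite add0r ler_pM2l//.
  by apply: (lerXn2r 2 _ _ (bl i)); rewrite nnegrE ?q0.
rewrite -/(b a).
have -> : x 0 a * (l / x 0 a + b a) ^+ 2 = l ^+ 2 / x 0 a + 2 * (l * b a) + x 0 a * b a ^+ 2.
  by field; rewrite gt_eqF.
rewrite !lerD//.
- by rewrite ler_piMl ?exprn_ile1// invr_ge0 (ltW (x0 a)).
- rewrite ler_pM2l// (le_trans _ (bl a))// ler_piMl//.
- by rewrite ler_pM2l//; apply: (lerXn2r 2 _ _ (bl a)); rewrite nnegrE ?q0.
Qed.

(** Holds for every arm and every loss in the unit interval; averaging comes later. The term
    [l * (u 0 a / x 0 a) - l] is the inner product of the loss estimate with [u - x]. *)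
Lemma potential_step (z : 'rV[R]_K) (a : 'I_K) (l : R) (x := Defs.proj alpha eps z) :
  posorth z -> 0 <= l <= 1 ->
  let z' := update alpha eta lambda eps z a l in
  posorth z' /\
  Dpsi alpha u z' <= Dpsi alpha u z + eta * (l * (u 0 a / x 0 a) - l + lambda * rho)
    + eta ^+ 2 / 2 * ((x 0 a)^-1 + 2 * (lambda / eps) + (lambda / eps) ^+ 2).
Proof.
move=> z0 l01 z'; have /andP[l0 l1] := l01.
have [Dx _] := projP alpha eps_gt0 D0 z0.
have x0 : posorth x := Delta_posorth eps_gt0 Dx.
have [] := updateP alpha01 a eta_gt0 lambda_ge0 eps_gt0 D0 z0 l0.
rewrite -/x -/z' => z'0 z'E; split=> //.
pose g i := (if i == a then l / x 0 i else 0) + lambda * (eps^-1 - (x 0 i)^-1).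
have g0 i : 0 <= g i.
  rewrite addr_ge0//; first by case: ifP => // _; rewrite divr_ge0// ltW.
  by rewrite mulr_ge0// subr_ge0 lef_pV2 ?posrE//; case: Dx.
(* [dpsi] is increasing and the mirror step lowers it by [eta * g i >= 0]; [div1_le_sqr] requires
   this order. *)
have z'x i : z' 0 i <= x 0 i.
  rewrite leNgt; apply/negP => /(mirror_lt (psi_mirror alpha01) (x0 i)).
  by rewrite z'E -/(g i) ltNge gerBl mulr_ge0// ltW.
have -> : Dpsi alpha u z' = Dpsi alpha u x + Dpsi alpha x z'
    + eta * \sum_i g i * (u 0 i - x 0 i).
  rewrite mulr_sumr -!big_split; apply: eq_bigr => i _ /=.
  rewrite (div1_three_point _ _ _ (x 0 i)) z'E -/(g i); congr (_ + _); ring.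
have H1 : Dpsi alpha u x <= Dpsi alpha u z by exact: proj_pythagoras.
have H2 : Dpsi alpha x z' <=
    eta ^+ 2 / 2 * ((x 0 a)^-1 + 2 * (lambda / eps) + (lambda / eps) ^+ 2).
  apply: le_trans (_ : eta ^+ 2 / 2 * \sum_i x 0 i * g i ^+ 2 <= _); last first.
    by rewrite ler_wpM2l ?divr_ge0 ?sqr_ge0// sum_sqr_estimate.
  rewrite mulr_sumr; apply: ler_sum => i _.
  have := div1_le_sqr (psi_mirror alpha01) (z'0 i) (z'x i) (Delta_le1 (ltW eps_gt0) Dx i).
  rewrite z'E -/(g i) => /le_trans; apply.
  by rewrite le_eqVlt; apply/orP; left; apply/eqP; field.
have H3 : eta * (\sum_i g i * (u 0 i - x 0 i)) <=
    eta * (l * (u 0 a / x 0 a) - l + lambda * rho).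
  rewrite ler_pM2l//.
  under eq_bigr do rewrite mulrDl.
  rewrite big_split/= lerD//.
    rewrite (bigD1 a)//= eqxx big1 ?addr0 => [|i /negbTE ->]; last by rewrite mul0r.
    by rewrite le_eqVlt; apply/orP; left; apply/eqP; field; rewrite gt_eqF.
  under eq_bigr do rewrite -mulrA.
  by rewrite -mulr_sumr ler_wpM2l// rhoP.
lra.
Qed.

Variable P : 'I_K -> probability R R.
Hypothesis suppP : forall a, P a `[0, 1]%classic = 1%E.
Variable m : R.
Hypothesis mP : \sum_j u 0 j * mean P j <= m.

Lemma exp_loss_le (n : nat) (z : 'rV[R]_K) : posorth z ->
  exp_loss alpha eta lambda eps P n z <=
  n%:R * (m + lambda * rho + eta / 2 * (K%:R + 2 * (lambda / eps) + (lambda / eps) ^+ 2))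
  + Dpsi alpha u z / eta.
Proof.
have u0 := Delta_posorth eps_gt0 Delta_u.
have m0 : 0 <= m.
  apply: le_trans mP; apply: sumr_ge0 => j _; rewrite mulr_ge0 ?(ltW (u0 j))//.
  by have /andP[] := Rintegral_id_itv01 (suppP j).
set q := 2 * (lambda / eps) + (lambda / eps) ^+ 2.
have q0 : 0 <= q by rewrite addr_ge0 ?sqr_ge0// mulr_ge0// divr_ge0// ltW.
rewrite -(addrA K%:R) -/q; set C := m + _ + _.
have C0 : 0 <= C.
  apply: addr_ge0; first by rewrite addr_ge0// mulr_ge0.
  by apply: mulr_ge0; [rewrite divr_ge0// ltW|rewrite addr_ge0].
elim: n z => [|n IH] z z0.
  by rewrite mul0r add0r divr_ge0 ?(ltW eta_gt0)// Dpsi_ge0.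
rewrite /=; set x := Defs.proj alpha eps z.
have [Dx _] := projP alpha eps_gt0 D0 z0.
have x0 : posorth x := Delta_posorth eps_gt0 Dx.
pose B j := n%:R * C + Dpsi alpha u z / eta + lambda * rho
  + eta / 2 * ((x 0 j)^-1 + q).
(* The comparison of integrals asks for a nonnegative majorant. *)
have B0 j : 0 <= B j.
  apply: addr_ge0; last first.
    apply: mulr_ge0; first by rewrite divr_ge0// ltW.
    by rewrite addr_ge0// invr_ge0 ltW.
  apply: addr_ge0; last exact: mulr_ge0.
  by apply: addr_ge0; [exact: mulr_ge0|rewrite divr_ge0 ?Dpsi_ge0// ltW].
(* The loss [l] just paid cancels the [- l] of the potential step, so the majorant is affine in [l]
   and its integral is explicit. *)
have step j : Rintegral (P j) setT
    (fun l => l + exp_loss alpha eta lambda eps P n (update alpha eta lambda eps z j l))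
    <= u 0 j / x 0 j * mean P j + B j.
  rewrite -(Rintegral_affine (suppP j)).
  apply: (Rintegral_ae_le (measurable_itv _) (null_outside_itv01 (suppP j))).
  - exact: integrable_affine.
  - move=> l; rewrite /= in_itv/= => l01.
    have [z'0 z'D] := potential_step j z0 l01.
    apply: (le_trans (lerD (lexx l) (IH _ z'0))).
    apply: (le_trans (lerD (lexx l) (lerD (lexx _) (ler_wpM2r _ z'D)))).
      by rewrite invr_ge0 ltW.
    rewrite le_eqVlt; apply/orP; left; apply/eqP; rewrite /B /q -/x.
    by field; rewrite !gt_eqF.
  - move=> l; rewrite /= in_itv/= => /andP[l0 _].
    by rewrite addr_ge0// mulr_ge0// divr_ge0// ltW.
apply: le_trans (_ : \sum_j x 0 j * (u 0 j / x 0 j * mean P j + B j) <= _).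
  by apply: ler_sum => j _; rewrite ler_pM2l.
(* Importance weighting: the sampling weights turn [u 0 j / x 0 j] into [u 0 j], and the terms
   [(x 0 j)^-1] add up to [K]. *)
have -> : \sum_j x 0 j * (u 0 j / x 0 j * mean P j + B j) =
  \sum_j u 0 j * mean P j + (n%:R * C + Dpsi alpha u z / eta + lambda * rho
    + eta / 2 * q) + eta / 2 * K%:R.
  have -> : K%:R = \sum_(j < K) 1 :> R by rewrite sumr_const card_ord.
  set E := _ + eta / 2 * q.
  have -> : E = \sum_j x 0 j * E by rewrite -mulr_suml; case: Dx => _ ->; rewrite mul1r.
  rewrite mulr_sumr -!big_split/=; apply: eq_bigr => j _.
  by rewrite /B /E -/x; field; rewrite !gt_eqF.
have CE : C = m + lambda * rho + eta / 2 * (K%:R + q) by [].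
rewrite -(natr1 n) mulrDl mul1r.
by move: mP; clearbody C; lra.
Qed.

End Potential.

(** * Logarithmic estimates for the explicit comparator *)

Lemma ln_leB1 {R : realType} {t : R} : 0 < t -> ln t <= t - 1.
Proof.
move=> t0; rewrite -[in ln t](subrK 1 t) addrC.
by apply: le_ln1Dx; lra.
Qed.

Section Comparator.
Set Implicit Arguments. Unset Strict Implicit.
Context {R : realType} {K : nat}.
Variables (eps : R) (b : 'I_K).
Hypotheses (eps_gt0 : 0 < eps) (Keps : K%:R * eps <= 1).

Definition comparator : 'rV[R]_K :=
  \row_j (eps + (if j == b then 1 - K%:R * eps else 0)).
Local Notation u := comparator.

Let K_gt0 : (0 : R) < K%:R.
Proof. by rewrite ltr0n; case: K b => // -[]. Qed.

Let K_ge1 : (1 : R) <= K%:R.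
Proof. by rewrite ler1n; case: K b => // -[]. Qed.

Let K_pred : (K.-1)%:R = K%:R - 1 :> R.
Proof. by rewrite -subn1 natrB// -(ler1n R). Qed.

Lemma comparator_Delta : Delta eps u.
Proof.
split=> [j|]; first by rewrite mxE lerDl; case: ifP; rewrite ?subr_ge0.
under eq_bigr do rewrite mxE.
rewrite big_split/= sumr_const card_ord -big_mkcond/= big_pred1_eq -[eps *+ K]mulr_natl.
by rewrite addrC subrK.
Qed.

(** [K u_b - 1 = (K - 1) (1 - K eps)]. Thus [ln (K u_b) >= 0], which lets later sums drop the term
    of the best arm. *)
Lemma comparator_ge : 1 <= K%:R * u 0 b.
Proof.
rewrite mxE eqxx.
have : 0 <= (K%:R - 1) * (1 - K%:R * eps) by rewrite mulr_ge0 ?subr_ge0.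
lra.
Qed.

Lemma sum_comparator_le (F : R -> R) (c : R) :
  F (u 0 b) <= 0 -> F eps <= c -> \sum_i F (u 0 i) <= (K%:R - 1) * c.
Proof.
move=> Fb Fe; rewrite (bigD1 b)//= -[leRHS]add0r lerD//.
apply: le_trans (_ : \sum_(i | i != b) c <= _).
  by apply: ler_sum => i /negbTE ib; rewrite mxE ib addr0.
by rewrite sumr_const cardC1 card_ord -[leLHS]mulr_natl K_pred.
Qed.

(** Each of the other [K - 1] arms takes mass [eps] away from [b], at a cost of at most [eps] for
    values in the unit interval. *)
Lemma sum_comparator_mean (c : 'I_K -> R) : (forall j, 0 <= c j <= 1) ->
  \sum_j u 0 j * c j <= c b + (K%:R - 1) * eps.
Proof.
move=> c01.
have -> : \sum_j u 0 j * c j = c b + \sum_j eps * (c j - c b).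
  rewrite -mulr_sumr sumrB sumr_const card_ord mulrBr mulr_sumr.
  under eq_bigr do rewrite mxE mulrDl.
  rewrite big_split/=.
  rewrite [X in _ + X = _](bigD1 b)//= eqxx [X in _ + (_ + X) = _]big1; last first.
    by move=> j /negbTE ->; rewrite mul0r.
  ring.
rewrite lerD2l (bigD1 b)//= subrr mulr0 add0r.
apply: le_trans (_ : \sum_(i | i != b) eps <= _).
  apply: ler_sum => i _; have := c01 i; have := c01 b => /andP[? ?] /andP[? ?].
  by rewrite ler_piMr ?(ltW eps_gt0)//; lra.
by rewrite sumr_const cardC1 card_ord -[leLHS]mulr_natl K_pred.
Qed.

Let u_gt0 := Delta_posorth eps_gt0 comparator_Delta.

Lemma sum_ln_comparator :
  \sum_i - ln (K%:R * u 0 i) <= (K%:R - 1) * - ln (K%:R * eps).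
Proof.
apply: (@sum_comparator_le (fun t => - ln (K%:R * t))) => //.
by rewrite oppr_le0 ln_ge0// comparator_ge.
Qed.

(** Apply [ln t <= t - 1] at [t = u_i / x_i] (convexity of the barrier) and at [t = K x_i]. The
    linear terms cancel in the sum, as [u] and [x] both have total mass 1. *)
Lemma barrier_comparator (x : 'rV[R]_K) : Delta eps x ->
  \sum_i (eps^-1 - (x 0 i)^-1) * (u 0 i - x 0 i) <= (K%:R - 1) * - ln (K%:R * eps).
Proof.
move=> Dx; have x0 := Delta_posorth eps_gt0 Dx.
apply: le_trans sum_ln_comparator.
apply: le_trans (_ : \sum_i (eps^-1 * (u 0 i - x 0 i) - ln (K%:R * u 0 i)
                              + (K%:R * x 0 i - 1)) <= _).
  apply: ler_sum => i _.
  have h1 := ln_leB1 (divr_gt0 (u_gt0 i) (x0 i)).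
  have h2 := ln_leB1 (mulr_gt0 K_gt0 (x0 i)).
  have ui : 0 < u 0 i := u_gt0 i.
  have xi : 0 < x 0 i := x0 i.
  move: h1 h2; rewrite ln_div ?posrE// !lnM ?posrE//.
  have -> : (eps^-1 - (x 0 i)^-1) * (u 0 i - x 0 i) =
     eps^-1 * (u 0 i - x 0 i) - u 0 i / x 0 i + 1.
    by field; rewrite !gt_eqF.
  lra.
rewrite !big_split/= -mulr_sumr !sumrB -mulr_sumr sumr_const card_ord.
by case: Dx comparator_Delta => _ -> [_ ->]; lra.
Qed.

(** [u] and the uniform point have equal mass, so the slope at the latter may be traded for any [c];
    later choices of [c] cancel the linear part of [psi]. *)
Lemma Dpsi_center (alpha c : R) :
  Dpsi alpha u (z1 R K) =
  \sum_i (psi alpha (u 0 i) - psi alpha K%:R^-1 - c * (u 0 i - K%:R^-1)).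
Proof.
have S0 a : \sum_i a * (u 0 i - K%:R^-1) = 0.
  rewrite -mulr_sumr sumrB sumr_const card_ord -[_^-1 *+ _]mulr_natl divff ?gt_eqF//.
  by case: comparator_Delta => _ ->; rewrite subrr mulr0.
rewrite sumrB S0 subr0 /Dpsi/div1.
under eq_bigr do rewrite [z1 _ _ _ _]mxE.
by rewrite sumrB S0 subr0.
Qed.

Lemma psi_center (alpha t : R) : alpha != 0 -> alpha != 1 ->
  psi alpha t - psi alpha K%:R^-1 - (1 - alpha)^-1 * (t - K%:R^-1) =
  (K%:R^-1 `^ alpha - t `^ alpha) / (alpha * (1 - alpha)).
Proof.
move=> a0 a1; rewrite /psi (negbTE a0) (negbTE a1).
have a1' : 1 - alpha != 0 by rewrite subr_eq0 eq_sym.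
by field; rewrite a0 a1' gt_eqF.
Qed.

Lemma Dpsi_center_small (alpha : R) : 0 <= alpha < 3^-1 ->
  Dpsi alpha u (z1 R K) <= (K%:R - 1) * (3 / 2 * - ln (K%:R * eps)).
Proof.
move=> /andP[a0 a1].
have lg0 : 0 <= - ln (K%:R * eps) by rewrite oppr_ge0 ln_le0.
have [a00|an0] := eqVneq alpha 0.
  rewrite (@Dpsi_center alpha 1).
  apply: (@sum_comparator_le (fun t => psi alpha t - psi alpha K%:R^-1 - 1 * (t - K%:R^-1))).
    have ub : 0 < u 0 b := u_gt0 b.
    have := ln_ge0 comparator_ge.
    rewrite /psi a00 eqxx lnV ?posrE// lnM ?posrE//.
    by move=> ?; lra.
  rewrite /psi a00 eqxx lnV ?posrE//.
  by move: lg0; rewrite lnM ?posrE// => ?; lra.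
have an1 : alpha != 1 by rewrite lt_eqF//; lra.
rewrite (@Dpsi_center alpha (1 - alpha)^-1).
under eq_bigr do rewrite psi_center//.
have agt0 : 0 < alpha by rewrite lt_neqAle eq_sym an0.
have k0 : 0 < alpha * (1 - alpha) by rewrite mulr_gt0//; lra.
pose z : R := K%:R^-1.
have z0 : 0 < z by rewrite invr_gt0.
have z1 : z `^ alpha <= 1.
  rewrite -(powRr0 z); have H : 0 < z <= 1 by rewrite z0 invf_le1.
  exact: (ger_powR H).
(* Write [t = z * (K t)] and use [expR s >= 1 + s] at [s = alpha * ln (K t)]. *)
have key (t : R) : 0 < t ->
    z `^ alpha - t `^ alpha <= z `^ alpha * (alpha * - ln (K%:R * t)).
  move=> t0; have Kt0 : 0 < K%:R * t by rewrite mulr_gt0.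
  have tE : t = z * (K%:R * t) by rewrite mulrA mulVf ?mul1r// gt_eqF.
  rewrite [in t `^ alpha]tE powRM ?(ltW z0) ?(ltW Kt0)//.
  have := expR_ge1Dx (alpha * ln (K%:R * t)).
  have -> : expR (alpha * ln (K%:R * t)) = (K%:R * t) `^ alpha.
    by rewrite /powR gt_eqF.
  rewrite -(ler_pM2l (powR_gt0 alpha z0)); lra.
apply: (@sum_comparator_le (fun t => (z `^ alpha - t `^ alpha) / (alpha * (1 - alpha)))).
  rewrite pmulr_lle0 ?invr_gt0//; apply: (le_trans (key _ (u_gt0 b))).
  rewrite mulr_ge0_le0 ?powR_ge0// mulr_ge0_le0// oppr_le0 ln_ge0//.
  exact: comparator_ge.
rewrite ler_pdivrMr//; apply: (le_trans (key _ eps_gt0)).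
move: lg0; set lg := - ln _ => lg0.
apply: (@le_trans _ _ (alpha * lg)).
  by rewrite ler_piMl// mulr_ge0.
(* The constant 3/2 is the value of [(1 - alpha)^-1] at [alpha = 1/3]. *)
have : 0 <= (alpha * lg) * (3 / 2 * (1 - alpha) - 1).
  by rewrite mulr_ge0 ?mulr_ge0//; lra.
lra.
Qed.

(** The constant 3 bounds [alpha^-1]. For [alpha < 1], coordinates at most 1 only grow when raised
    to the power [alpha], which leaves [w - 1] with [w] equal to [K] to the power [1 - alpha]; then
    [w - 1 <= w * ln w <= K * ln w]. *)
Lemma Dpsi_center_large (alpha : R) : 3^-1 <= alpha <= 1 ->
  Dpsi alpha u (z1 R K) <= 3 * K%:R * ln K%:R.
Proof.
move=> /andP[a0 a1].
have lK0 : 0 <= ln (K%:R : R) by rewrite ln_ge0.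
have u1 := Delta_le1 (ltW eps_gt0) comparator_Delta.
have agt0 : 0 < alpha by lra.
have an0 : alpha != 0 by rewrite gt_eqF.
have [a11|an1] := eqVneq alpha 1.
  rewrite (@Dpsi_center alpha (-1)).
  apply: (@le_trans _ _ (\sum_(i < K) (K%:R^-1 * ln K%:R))).
    apply: ler_sum => i _; rewrite /psi (negbTE an0) a11 eqxx lnV ?posrE//.
    have : u 0 i * ln (u 0 i) <= 0.
      by rewrite pmulr_rle0 ?ln_le0//; exact: u_gt0.
    lra.
  rewrite sumr_const card_ord -[leLHS]mulr_natl mulrA divff ?gt_eqF// mul1r.
  by rewrite ler_peMl//; have := K_ge1; lra.
rewrite (@Dpsi_center alpha (1 - alpha)^-1).
under eq_bigr do rewrite psi_center//.
rewrite -mulr_suml.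
have a1' : 0 < 1 - alpha by rewrite subr_gt0 lt_neqAle an1.
rewrite ler_pdivrMr ?mulr_gt0//.
pose z : R := K%:R^-1.
have z0 : 0 < z by rewrite invr_gt0.
have z1 : z `^ alpha <= 1.
  rewrite -(powRr0 z); have H : 0 < z <= 1 by rewrite z0 invf_le1.
  by apply: (ger_powR H); exact: ltW.
pose w := K%:R * z `^ alpha.
have w0 : 0 < w by rewrite mulr_gt0// powR_gt0.
have lw : ln w = (1 - alpha) * ln K%:R.
  by rewrite lnM ?posrE ?powR_gt0// ln_powR lnV ?posrE//; ring.
have wK : w <= K%:R by rewrite ler_piMr// ltW.
have w1 : w - 1 <= w * ln w.
  have : ln w^-1 <= w^-1 - 1 by apply: ln_leB1; rewrite invr_gt0.
  rewrite lnV ?posrE// -(ler_pM2l w0) mulrBr divff ?gt_eqF//; lra.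
apply: (@le_trans _ _ (w - 1)).
  rewrite sumrB sumr_const card_ord -[_ `^ _ *+ _]mulr_natl lerD2l lerN2.
  case: comparator_Delta => _ <-; apply: ler_sum => i _.
  by apply: ger1_powR => //; rewrite u1 u_gt0.
apply: (le_trans w1); rewrite lw.
apply: (@le_trans _ _ (K%:R * ((1 - alpha) * ln K%:R))).
  by rewrite ler_wpM2r// mulr_ge0// ltW.
have : 0 <= K%:R * ln K%:R * (1 - alpha) * (3 * alpha - 1).
  by rewrite !mulr_ge0 ?(ltW K_gt0) ?(ltW a1')//; lra.
lra.
Qed.

End Comparator.

(** * Choice of the parameters and the final regret bound *)

(** Here [s], [q], [L], [g] stand for the square roots of [T] and [K], for [ln T] and for [gamma T].
    The cross term [g / (q * L)] is paid by the [- L] in [(k - 1) * L]; the barrier and quadratic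
    terms share [g * L * q]. *)
Lemma regret_arith (R : realType) (s q L g D E : R) (k := q ^+ 2)
    (eps := L / s) (eta := s^-1) (lambda := g / (q * s)) :
  0 < s -> 1 <= q -> 2^-1 <= L -> 0 < g -> g <= L ^+ 2 ->
  k * L + k / 2 + D <= E ->
  s ^+ 2 * ((k - 1) * eps + lambda * ((k - 1) * (L / 2))
    + eta / 2 * (k + 2 * (lambda / eps) + (lambda / eps) ^+ 2)) + D / eta
  <= (E + g * L * q) * s.
Proof.
move=> s0 q1 L1 g0 gL HE.
have q0 : 0 < q by lra.
have L0 : 0 < L by lra.
have -> : s ^+ 2 * ((k - 1) * eps + lambda * ((k - 1) * (L / 2))
    + eta / 2 * (k + 2 * (lambda / eps) + (lambda / eps) ^+ 2)) + D / eta =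
  ((k - 1) * L + k / 2 + D + g / (q * L)
    + g * ((k - 1) / q * (L / 2) + g / (L ^+ 2) / (2 * k))) * s.
  by rewrite /k /eps /eta /lambda; field; rewrite !gt_eqF.
rewrite ler_pM2r//.
have cross : g / (q * L) <= L.
  rewrite ler_pdivrMr ?mulr_gt0// (le_trans gL)// expr2 mulrCA.
  by rewrite ler_peMl// mulr_ge0 ?(ltW L0).
have quad : g / L ^+ 2 / (2 * k) <= (2 * k)^-1.
  apply: ler_piMl; first by rewrite invr_ge0 mulr_ge0 ?sqr_ge0.
  by rewrite ler_pdivrMr ?exprn_gt0// mul1r.
(* The barrier term leaves room [L (q + q^-1) / 2], which absorbs [(2 k)^-1] because [L >= 1/2]. *)
have barrier : (k - 1) / q * (L / 2) + (2 * k)^-1 <= L * q.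
  have q1' : q^-1 <= 1 by rewrite invf_le1.
  have -> : (k - 1) / q = q - q^-1 by rewrite /k; field; rewrite gt_eqF.
  have -> : (2 * k)^-1 = q^-1 ^+ 2 / 2 by rewrite /k; field; rewrite gt_eqF.
  have i0 : 0 < q^-1 by rewrite invr_gt0.
  have : q^-1 ^+ 2 <= q^-1 by rewrite expr2 ler_piMl// ltW.
  have : 0 <= (L - 2^-1) * (q + q^-1) by rewrite mulr_ge0//; lra.
  lra.
have : g * ((k - 1) / q * (L / 2) + g / L ^+ 2 / (2 * k)) <= g * (L * q).
  by rewrite ler_pM2l//; lra.
lra.
Qed.

Lemma ln_nat_ge_half (R : realType) (n : nat) : (1 < n)%N -> 2^-1 <= ln (n%:R : R).
Proof.
move=> n1; have n0 : (0 : R) < n%:R by rewrite ltr0n (ltn_trans _ n1).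
have n2 : (2 : R) <= n%:R by rewrite ler_nat.
have : ln (n%:R^-1 : R) <= n%:R^-1 - 1 by apply: ln_leB1; rewrite invr_gt0.
have : (n%:R^-1 : R) <= 2^-1 by rewrite lef_pV2 ?posrE.
by rewrite lnV ?posrE//; lra.
Qed.

Lemma ln_sqrt_nat (R : realType) (n : nat) : (0 < n)%N ->
  ln (Num.sqrt (n%:R : R)) = ln n%:R / 2.
Proof.
move=> n0; have s0 : 0 < Num.sqrt (n%:R : R) by rewrite sqrtr_gt0 ltr0n.
by rewrite -[in RHS](@sqr_sqrtr R n%:R)// lnXn//; field.
Qed.

Lemma exploration_log_le (R : realType) (K T : nat) : (0 < K)%N -> (1 < T)%N ->
  (K%:R - 1) * - ln (K%:R * (ln T%:R / Num.sqrt (T%:R : R))) <=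
  (K%:R - 1) * (ln T%:R / 2).
Proof.
case: K => [//|[|K]] _ T1; first by rewrite subrr !mul0r.
have L1 := @ln_nat_ge_half R _ T1.
have s0 : 0 < Num.sqrt (T%:R : R) by rewrite sqrtr_gt0 ltr0n (ltn_trans _ T1).
have K2 : (2 : R) <= K.+2%:R by rewrite ler_nat.
have L0 : 0 < ln (T%:R : R) by lra.
have K0 : (0 : R) < K.+2%:R by lra.
rewrite ler_pM2l; last lra.
rewrite mulrA ln_div ?posrE ?mulr_gt0// ln_sqrt_nat ?(ltn_trans _ T1)//.
have : 0 <= ln (K.+2%:R * ln (T%:R : R)).
  rewrite ln_ge0//; have : 0 <= (K.+2%:R - 2) * ln (T%:R : R).
    by rewrite mulr_ge0 ?subr_ge0// ltW.
  lra.
lra.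
Qed.

Theorem theorem2 (R : realType) (K : nat) (hK : (0 < K)%N)
  (P : 'I_K -> probability R R)
  (hsupp : forall a, P a `[0, 1]%classic = 1%E)
  (alpha : R) (halpha : 0 <= alpha <= 1)
  (gamma : nat -> R)
  (hgpos : forall T, 0 < gamma T)
  (hgle : forall T, (2 <= T)%N -> gamma T <= ln T%:R ^+ 2)
  (hglim : (fun T => gamma T / ln T%:R ^+ 2) @ \oo --> (0 : R))
  (hglim2 : alpha < 3^-1 -> (fun T => ln T%:R / gamma T) @ \oo --> (0 : R))
  (T : nat) (hT : (2 <= T)%N)
  (hwd : (K%:R : R) * (ln T%:R / Num.sqrt (T%:R : R)) <= 1) :
  let eta := (Num.sqrt (T%:R : R))^-1 in
  let eps := ln T%:R / Num.sqrt (T%:R : R) in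
  let lambda := gamma T / Num.sqrt (K%:R * T%:R : R) in
  regret alpha eta lambda eps P (Ordinal hK) T <=
    (if alpha < 3^-1 then
       (4 * Num.sqrt (K%:R : R) * ln T%:R + gamma T * ln T%:R) * Num.sqrt (K%:R * T%:R : R)
     else
       (4 * Num.sqrt (K%:R : R) * ln (K%:R : R) + 2 * Num.sqrt (K%:R : R) * ln T%:R
          + gamma T * ln T%:R) * Num.sqrt (K%:R * T%:R : R)).
Proof.
cbv zeta; set eta := (Num.sqrt T%:R)^-1; set eps := ln T%:R / Num.sqrt T%:R.
set lambda := gamma T / _.
have T0 : (0 < T)%N by rewrite (ltn_trans _ hT).
have K1 : (1 : R) <= K%:R by rewrite ler1n.
have L1 := @ln_nat_ge_half R _ hT.
have s0 : 0 < Num.sqrt (T%:R : R) by rewrite sqrtr_gt0 ltr0n.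
have s2 : Num.sqrt (T%:R : R) ^+ 2 = T%:R by rewrite sqr_sqrtr.
have q1 : 1 <= Num.sqrt (K%:R : R) by rewrite -[leLHS]sqrtr1 ler_wsqrtr.
have q2 : Num.sqrt (K%:R : R) ^+ 2 = K%:R by rewrite sqr_sqrtr.
have eps0 : 0 < eps by rewrite divr_gt0//; lra.
have eta0 : 0 < eta by rewrite invr_gt0.
have lambda0 : 0 <= lambda by rewrite divr_ge0 ?sqrtr_ge0// ltW.
pose b := [arg min_(j < Ordinal hK) mean P j]%O.
have bmin j : mean P b <= mean P j.
  by rewrite /b; case: arg_minP => // i _ /(_ j); exact.
pose u : 'rV[R]_K := comparator eps b.
(* [hwd] is [K eps <= 1]: the mass left for the best arm is nonnegative. *)
have Du : Delta eps u := comparator_Delta b hwd.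
pose rho : R := (K%:R - 1) * (ln T%:R / 2).
have rho0 : 0 <= rho by rewrite mulr_ge0 ?subr_ge0//; lra.
have rhoP (x : 'rV[R]_K) : Delta eps x ->
    \sum_i (eps^-1 - (x 0 i)^-1) * (u 0 i - x 0 i) <= rho.
  move=> Dx; apply: (@le_trans _ _ ((K%:R - 1) * - ln (K%:R * eps))).
    exact: barrier_comparator.
  exact: exploration_log_le.
have mP : \sum_j u 0 j * mean P j <= mean P b + (K%:R - 1) * eps.
  by apply: sum_comparator_mean => // j; exact: Rintegral_id_itv01.
have z10 : posorth (z1 R K) by move=> i; rewrite mxE invr_gt0 ltr0n.
have loss := exp_loss_le halpha eta0 lambda0 eps0 Du rho0 rhoP hsupp mP T z10.
have min_le : T%:R * mean P b <= T%:R * \big[Num.min/mean P (Ordinal hK)]_(j < K) mean P j.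
  by rewrite ler_wpM2l//; apply: le_bigmin.
set D := Dpsi alpha u (z1 R K) in loss.
have master (E : R) : K%:R * ln T%:R + K%:R / 2 + D <= E ->
    regret alpha eta lambda eps P (Ordinal hK) T <=
    (E + gamma T * ln T%:R * Num.sqrt K%:R) * Num.sqrt T%:R.
  move=> DE.
  have := @regret_arith R (Num.sqrt T%:R) (Num.sqrt K%:R) (ln T%:R) (gamma T) D E
    s0 q1 L1 (hgpos T) (hgle T hT).
  rewrite q2 -sqrtrM ?ler0n// -/eps -/eta -/lambda s2 -/rho => /(_ DE).
  by apply: le_trans; rewrite /regret; lra.
rewrite sqrtrM ?ler0n//.
have Kp : 0 <= (K%:R - 1) * (ln T%:R : R) by rewrite mulr_ge0; lra.
have Kh : 0 <= K%:R * (ln T%:R - 2^-1 : R) by rewrite mulr_ge0; lra.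
case: ltP => a3.
  have a3' : 0 <= alpha < 3^-1 by case/andP: halpha => -> _.
  have := Dpsi_center_small b eps0 hwd a3'; rewrite -/u -/D => DD.
  (* [K / 2] is at most [K ln T], and [D] at most [3/4 (K - 1) ln T]. *)
  have DE : K%:R * ln T%:R + K%:R / 2 + D <= 4 * K%:R * ln T%:R.
    have := @exploration_log_le R _ _ hK hT; rewrite -/eps; lra.
  apply: le_trans (master _ DE) _.
  by rewrite -[X in 4 * X]q2 le_eqVlt; apply/orP; left; apply/eqP; ring.
have a3' : 3^-1 <= alpha <= 1 by rewrite a3; case/andP: halpha.
have := Dpsi_center_large b eps0 hwd a3'; rewrite -/u -/D => DD.
have lnK0 : 0 <= K%:R * ln (K%:R : R) by rewrite mulr_ge0 ?ln_ge0.
have DE : K%:R * ln T%:R + K%:R / 2 + D <= 4 * K%:R * ln K%:R + 2 * K%:R * ln T%:R.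
  by lra.
apply: le_trans (master _ DE) _.
rewrite -[X in 4 * X]q2 -[X in 2 * X]q2.
by rewrite le_eqVlt; apply/orP; left; apply/eqP; ring.
Qed.
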